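(* Let $X=(\xi,\rho)$ be an optimal solution of the linear program (MP-SL1). If all variables $\xi_{ls}$ ($l\in\mathcal{L}$, $s\in\mathcal{S}$) are integral, then either $X$ is integral, or there exists an integral feasible solution $X'$ of (MP-SL1) with the same objective value as $X$.
   Context: Data: a finite set $\mathcal{L}$ of storage locations, each $l$ with positive integer capacity $K_l$; a finite set $\mathcal{S}$ of SKUs; a finite set $\mathcal{O}$ of orders, each $o$ with SKU set $\mathcal{S}(o)\subseteq\mathcal{S}$; fixed assignments $\mathcal{F}\subseteq\mathcal{S}\times\mathcal{L}$. Storage nodes $\mathcal{V}=\bigcup_{l}\{v_l^1,\dots,v_l^{K_l}\}$, $\mathcal{V}(l)=\{v_l^1,\dots,v_l^{K_l}\}$, plus drop-off point $v_0$; directed graph $\mathcal{G}$ on $\mathcal{V}\cup\{v_0\}$ with arcs $(v_0,v_l^1)$, $(v_l^i,v_0)$, $(v_l^i,v_{l'}^1)$ for all $l,l'\in\mathcal{L}$ and $1\le i\le K_l$, and $(v_l^i,v_l^{i+1})$ for $1\le i\le K_l-1$. For each order $o$, $\mathcal{R}_o$ is the finite set of routes for $o$: tours in $\mathcal{G}$ starting and ending at $v_0$, visiting each node at most once, and visiting exactly $|\mathcal{S}(o)|$ storage nodes; each route $r$ has a cost $c_{or}\in\mathbb{R}$ (the walking distance of the route under the chosen routing policy); $a_{or}^l$ is the number of nodes of $\mathcal{V}(l)$ visited by $r$, and $b_{or}^l=1$ if $a_{or}^l\ge1$, $0$ otherwise. (MP-SL1) is the linear program: minimize $\sum_{o}\sum_{r\in\mathcal{R}_o}c_{or}\rho_{or}$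 subject to $\sum_{s}\xi_{ls}\le K_l$ ($l\in\mathcal{L}$); $\sum_{l}\xi_{ls}=1$ ($s\in\mathcal{S}$); $\xi_{ls}=1$ ($(s,l)\in\mathcal{F}$); $\sum_{r\in\mathcal{R}_o}\rho_{or}=1$ ($o\in\mathcal{O}$); $\sum_{r\in\mathcal{R}_o}a_{or}^l\rho_{or}\ge\sum_{s\in\mathcal{S}(o)}\xi_{ls}$ ($l\in\mathcal{L},o\in\mathcal{O}$); $\sum_{r\in\mathcal{R}_o}b_{or}^l\rho_{or}\ge\xi_{ls}$ ($l\in\mathcal{L},o\in\mathcal{O},s\in\mathcal{S}(o)$); $\rho_{or}\ge0$, $\xi_{ls}\ge0$. It is the linear relaxation of the route-based formulation of the problem strengthened by the last family of inequalities (called SL-1 inequalities). *)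

(* Defs.v *)
From HB Require Import structures.
From mathcomp Require Import all_boot all_order all_algebra.
From mathcomp Require Import reals.

Set Implicit Arguments.
Unset Strict Implicit.
Unset Printing Implicit Defensive.

Import Order.TTheory GRing.Theory Num.Theory.
Local Open Scope ring_scope.

(* [walk o ls] is the walking distance, under the chosen routing policy, of a
   tour for order [o] that starts and ends at the drop-off point and stops at
   the locations [ls] in that order.  The storage nodes of a location all stand
   for the same physical place, so the walking distance of a route is determined
   by the sequence of its stops, whatever the policy (for policies that fix the
   visiting order themselves, [walk o ls] depends only on the set of stops). *)
Record instance (R : realType) := Instance {
  loc : finType;
  sku : finType;
  order : finType;
  cap : loc -> nat;
  cap_gt0 : forall l, (0 < cap l)%N;
  skus : order -> {set sku};
  fixed : {set sku * loc};
  walk : order -> seq loc -> R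
}.

(* The node v_l^i, 1 <= i <= K_l, is [Tagged _ (i - 1)] with tag l. *)
Definition node (R : realType) (I : instance R) : finType :=
  {l : loc I & 'I_(cap l)}.

Definition node_loc (R : realType) (I : instance R) (v : node I) : loc I :=
  tag v.

Definition node_rank (R : realType) (I : instance R) (v : node I) : nat :=
  tagged v.

(* Arcs of the graph on the storage nodes and v_0 = [None]. *)
Definition arc (R : realType) (I : instance R) : rel (option (node I)) :=
  fun u v =>
    match u, v with
    | None, None => false
    | None, Some v' => node_rank v' == 0%N
    | Some _, None => true
    | Some u', Some v' =>
        (node_rank v' == 0%N)
        || ((node_loc u' == node_loc v')
            && (node_rank v' == (node_rank u').+1))
    end.

(* A tour from v_0 to v_0 is given by the sequence of its storage nodes; the
   empty sequence is the trivial tour that stays at v_0. *)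
Definition tour (R : realType) (I : instance R) (p : seq (node I)) : bool :=
  uniq p && (nilp p || cycle (@arc R I) (None :: map Some p)).

Definition route (R : realType) (I : instance R) (o : order I) : finType :=
  {p : #|skus o|.-tuple (node I) | tour p}.

Definition visits (R : realType) (I : instance R) (o : order I) (r : route o)
    (l : loc I) : nat :=
  count (fun v => node_loc v == l) (val r).

Definition visited (R : realType) (I : instance R) (o : order I) (r : route o)
    (l : loc I) : bool :=
  (0 < visits r l)%N.

(* The nodes of a location visited by a tour are consecutive in it, since a
   location is entered through v_l^1 only: [undup] just contracts each such
   block to one stop. *)
Definition stops (R : realType) (I : instance R) (o : order I) (r : route o) :
    seq (loc I) :=
  undup [seq node_loc v | v <- val r].

Definition cost (R : realType) (I : instance R) (o : order I) (r : route o) :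
    R :=
  walk o (stops r).

Record solution (R : realType) (I : instance R) := Solution {
  xi : loc I -> sku I -> R;
  rho : forall o : order I, route o -> R
}.

Definition objective (R : realType) (I : instance R) (X : solution I) : R :=
  \sum_(o : order I) \sum_(r : route o) cost r * rho X r.

Record feasible (R : realType) (I : instance R) (X : solution I) : Prop := {
  feas_cap : forall l, \sum_s xi X l s <= (cap l)%:R;
  feas_assign : forall s, \sum_l xi X l s = 1;
  feas_fixed : forall s l, (s, l) \in fixed I -> xi X l s = 1;
  feas_route : forall o : order I, \sum_(r : route o) rho X r = 1;
  feas_link : forall l (o : order I),
    \sum_(r : route o) (visits r l)%:R * rho X r >= \sum_(s in skus o) xi X l s;
  feas_SL1 : forall l (o : order I) s, s \in skus o ->
    \sum_(r : route o) (visited r l)%:R * rho X r >= xi X l s;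
  feas_rho_ge0 : forall (o : order I) (r : route o), 0 <= rho X r;
  feas_xi_ge0 : forall l s, 0 <= xi X l s
}.

Definition optimal (R : realType) (I : instance R) (X : solution I) : Prop :=
  feasible X /\ forall Y : solution I, feasible Y -> objective X <= objective Y.

Definition xi_integral (R : realType) (I : instance R) (X : solution I) :
    Prop :=
  forall l s, xi X l s \is a Num.int.

Definition rho_integral (R : realType) (I : instance R) (X : solution I) :
    Prop :=
  forall (o : order I) (r : route o), rho X r \is a Num.int.

Definition integral_solution (R : realType) (I : instance R) (X : solution I) :
    Prop :=
  xi_integral X /\ rho_integral X.

(* Main.v *)
(* Since xi is a 0/1 assignment, fix an order o and let n l be the number of its
   SKUs stored at l.  Every route for o visits sum_l n l nodes, so the linking
   constraints are tight: a route r with rho r > 0 avoids the locations with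
   n l = 0, and by the SL-1 inequalities it stops at all those with n l >= 1.
   Its visit numbers may still differ from n, but the tour with the same stops
   that collects exactly v_l^1, ..., v_l^(n l) at each of them has the same
   cost.  Doing this to a cheapest route in the support of each order gives an
   integral feasible solution that costs no more than X. *)
Require Import Defs.
From HB Require Import structures.
From mathcomp Require Import all_boot all_order all_algebra.
From mathcomp Require Import reals.

Set Implicit Arguments.
Unset Strict Implicit.
Unset Printing Implicit Defensive.

Import Order.TTheory GRing.Theory Num.Theory.
Local Open Scope ring_scope.

(** * Sequences of constant blocks *)

Section NseqBlocks.
Variables (T : eqType) (n : T -> nat).
Implicit Type s : seq T.

Let blocks s := flatten [seq nseq (n x) x | x <- s].

Lemma mem_nseq_blocks s x : x \in blocks s -> x \in s.
Proof. by case/flatten_mapP=> y ys; rewrite mem_nseq => /andP[_ /eqP->]. Qed.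

Lemma count_nseq_blocks s x :
  uniq s -> count_mem x (blocks s) = ((x \in s) * n x)%N.
Proof.
elim: s => //= y s IHs /andP[ys us].
rewrite /blocks /= count_cat -/(blocks s) IHs // count_nseq inE /= [x == y]eq_sym.
by case: eqP => //= <-; rewrite (negPf ys) addn0.
Qed.

Lemma undup_nseq_blocks s :
  uniq s -> {in s, forall x, (0 < n x)%N} -> undup (blocks s) = s.
Proof.
elim: s => //= y s IHs /andP[ys us] n_gt0.
rewrite /blocks /= -/(blocks s).
have: (0 < n y)%N by apply: n_gt0; rewrite mem_head.
have ybs : y \notin blocks s by apply: contra ys; apply: mem_nseq_blocks.
have IH : undup (blocks s) = s.
  by apply: IHs => // x xs; apply: n_gt0; rewrite inE xs orbT.
(* [undup] keeps last occurrences: each copy of [y] but the last is dropped, and the last survives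
   because [y] is absent from the later blocks. *)
elim: (n y) => //= [[_ _|k IHk _]] /=; first by rewrite (negPf ybs) IH.
by rewrite inE eqxx /=; apply: IHk.
Qed.

End NseqBlocks.

(** * Tours with prescribed stops and visit numbers *)

Section Tours.
Variables (R : realType) (I : instance R).

Lemma arc_path_ranks l (q : seq (node I)) m u :
    all (fun v => node_loc v == l) q ->
    map (@node_rank R I) q = iota m (size q) ->
    (forall v, node_loc v = l -> node_rank v = m -> @Defs.arc R I u (Some v)) ->
  path (@Defs.arc R I) u (map Some q).
Proof.
elim: q m u => //= v q IHq m u /andP[/eqP vl ql] [vm qm] uv.
rewrite uv //=; apply: IHq qm _ => // w wl wm.
by rewrite /= vl wl eqxx wm vm eqxx orbT.
Qed.

Variables (n : loc I -> nat) (n_le_cap : forall l, (n l <= cap l)%N).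

Definition block l : seq (node I) :=
  [seq Tagged (fun l => 'I_(cap l)) (widen_ord (n_le_cap l) i) | i <- enum 'I_(n l)].

Lemma size_block l : size (block l) = n l.
Proof. by rewrite size_map size_enum_ord. Qed.

Lemma block_loc l : map (@node_loc R I) (block l) = nseq (n l) l.
Proof.
rewrite -map_comp -[in RHS](size_enum_ord (n l)).
by elim: (enum _) => //= i s ->.
Qed.

Lemma block_rank l : map (@node_rank R I) (block l) = iota 0 (n l).
Proof. by rewrite -map_comp -val_enum_ord. Qed.

Definition tour_of s : seq (node I) := flatten (map block s).

Lemma tour_of_loc s :
  map (@node_loc R I) (tour_of s) = flatten [seq nseq (n l) l | l <- s].
Proof.
by rewrite map_flatten -map_comp; congr flatten; apply: eq_map => l; apply: block_loc.
Qed.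

Lemma size_tour_of s : size (tour_of s) = (\sum_(l <- s) n l)%N.
Proof.
rewrite size_flatten sumnE /shape -map_comp big_map.
by apply: eq_bigr => l _; apply: size_block.
Qed.

(** Nodes of one block differ in rank, nodes of different blocks in location. *)
Lemma uniq_tour_of s : uniq s -> uniq (tour_of s).
Proof.
elim: s => //= l s IHs /andP[ls us]; rewrite cat_uniq IHs // andbT.
apply/andP; split.
  by apply: (@map_uniq _ _ (@node_rank R I)); rewrite block_rank iota_uniq.
apply/hasPn => v /(map_f (@node_loc R I)); rewrite tour_of_loc => vs.
apply: contra ls => /= /(map_f (@node_loc R I)).
by rewrite block_loc mem_nseq => /andP[_ /eqP <-]; apply: mem_nseq_blocks vs.
Qed.

(** Each block starts at rank 0, which has an arc from every other location and from the drop-off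
    point; inside a block the rank grows by one. Keeping [u] arbitrary lets the induction pass from
    block to block. *)
Lemma path_tour_of s u : path (@Defs.arc R I) u (map Some (tour_of s)).
Proof.
elim: s u => //= l s IHs u; rewrite map_cat cat_path IHs andbT.
apply: (@arc_path_ranks l _ 0) => [||v _ v0].
- by have := all_pred1_nseq l (n l); rewrite -block_loc all_map.
- by rewrite block_rank size_block.
- by case: u => [u|] /=; rewrite v0.
Qed.

Lemma tour_tour_of s : uniq s -> tour (tour_of s).
Proof.
move=> us; rewrite /tour uniq_tour_of //=.
have := path_tour_of s None; case: (tour_of s) => //= v p.
by rewrite rcons_path => /andP[-> ->] /=; rewrite last_map.
Qed.

End Tours.

(** * Routes of a single order *)

Section Orders.
Variables (R : realType) (I : instance R).

Lemma sum_visits (o : Defs.order I) (r : route o) : (\sum_l visits r l = #|skus o|)%N.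
Proof.
rewrite -[RHS](size_tuple (val r)) /visits.
elim: (tval (val r)) => [|v p IHp] /=; first by rewrite big1.
rewrite big_split IHp (bigD1 (node_loc v)) //= eqxx big1 // => l.
by rewrite eq_sym => /negPf->.
Qed.

Lemma mem_stops (o : Defs.order I) (r : route o) l : (l \in stops r) = visited r l.
Proof.
rewrite mem_undup /visited /visits -has_count.
by apply/mapP/hasP => [[v vr ->]|[v vr /eqP<-]]; exists v.
Qed.

(** The cost sees only the stops, so [tour_of] is applied to the stops of [r]. As [n] is positive
    exactly there, no block is empty and the stops come back in the same order. *)
Lemma route_with_visits (o : Defs.order I) (r : route o) (n : loc I -> nat) :
    (forall l, (n l <= cap l)%N) -> (\sum_l n l = #|skus o|)%N ->
    (forall l, visited r l = (0 < n l)%N) ->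
  exists r' : route o, (forall l, visits r' l = n l) /\ cost r' = cost r.
Proof.
move=> ncap nsum nr.
have us : uniq (stops r) by apply: undup_uniq.
have n0 l : l \notin stops r -> n l = 0%N by rewrite mem_stops nr lt0n negbK => /eqP.
have szp : size (tour_of ncap (stops r)) == #|skus o|.
  rewrite size_tour_of -nsum big_uniq //=; apply/eqP.
  by rewrite [RHS](bigID (mem (stops r))) /= [X in (_ + X)%N]big1 ?addn0.
pose r' : route o := Sub (Tuple szp) (tour_tour_of ncap us).
exists r'; split=> [l|].
  rewrite /visits -(count_map _ (pred1 l)) tour_of_loc count_nseq_blocks //.
  by have [_|/n0->] := boolP (l \in stops r); rewrite ?mul1n ?muln0.
rewrite /cost; congr walk; rewrite {1}/stops tour_of_loc undup_nseq_blocks //.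
by move=> l; rewrite mem_stops nr.
Qed.

Variables (X : solution I) (X_feas : feasible X) (X_int : xi_integral X).

Lemma xi_01 l s : xi X l s = (xi X l s == 1)%:R.
Proof.
have xi0 := feas_xi_ge0 X_feas.
have xi1 : xi X l s <= 1.
  by rewrite -(feas_assign X_feas s) (bigD1 l) //= lerDl sumr_ge0.
have /natrP[k xik] : xi X l s \is a Num.nat by rewrite natrEint X_int xi0.
by move: xi1; rewrite xik lern1 pnatr_eq1; case: k {xik} => [|[|]].
Qed.

Definition demand (o : Defs.order I) l : nat := #|[set s in skus o | xi X l s == 1]|.

Lemma demandE o l : (demand o l)%:R = \sum_(s in skus o) xi X l s.
Proof.
rewrite /demand -sum1_card natr_sum big_mkcond [RHS]big_mkcond /=.
apply: eq_bigr => s _; rewrite inE [in RHS]xi_01.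
by case: (s \in skus o); case: (xi X l s == 1).
Qed.

Lemma demand_le_cap o l : (demand o l <= cap l)%N.
Proof.
rewrite -(ler_nat R) demandE; apply: le_trans (feas_cap X_feas l).
rewrite [leRHS](bigID (mem (skus o))) /= lerDl.
by apply: sumr_ge0 => s _; apply: feas_xi_ge0.
Qed.

Lemma sum_demand o : (\sum_l demand o l = #|skus o|)%N.
Proof.
apply/eqP; rewrite -(eqr_nat R) natr_sum; under eq_bigr do rewrite demandE.
rewrite exchange_big /= -sum1_card natr_sum.
by under eq_bigr do rewrite (feas_assign X_feas).
Qed.

(** Summed over all locations, both sides give [#|skus o|], because the route weights add up to 1.
    Nonnegative slacks with sum 0 all vanish. *)
Lemma link_tight o l :
  \sum_(r : route o) (visits r l)%:R * rho X r = (demand o l)%:R.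
Proof.
pose slack l := \sum_(r : route o) (visits r l)%:R * rho X r - (demand o l)%:R.
have slack_ge0 m : 0 <= slack m by rewrite subr_ge0 demandE feas_link.
apply/eqP; rewrite -subr_eq0 -/(slack l); apply/eqP.
apply: (psumr_eq0P (P := predT) (F := slack)) => //.
rewrite sumrB -natr_sum sum_demand exchange_big /=.
under eq_bigr do rewrite -mulr_suml -natr_sum sum_visits.
by rewrite -mulr_sumr (feas_route X_feas) mulr1 subrr.
Qed.

Lemma support_visited o (r : route o) l :
  0 < rho X r -> visited r l = (0 < demand o l)%N.
Proof.
move=> r_gt0; have rho0 := @feas_rho_ge0 _ _ _ X_feas o.
have [d0|d_gt0] := posnP (demand o l).
  have := @psumr_eq0P _ _ predT (fun r : route o => (visits r l)%:R * rho X r).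
  rewrite link_tight d0 => /(_ (fun r _ => mulr_ge0 (ler0n _ _) (rho0 r)) erefl r isT).
  move/eqP; rewrite mulf_eq0 (gt_eqF r_gt0) orbF pnatr_eq0 /visited.
  by move/eqP->.
have /card_gt0P[s] := d_gt0; rewrite inE => /andP[so /eqP xi1].
have F_ge0 (q : route o) : predT q -> 0 <= (~~ visited q l)%:R * rho X q.
  by rewrite mulr_ge0.
(* The SL-1 inequality for a SKU with [xi X l s = 1] puts the whole unit of weight on routes that
   stop at [l]. *)
have F_sum : \sum_(q : route o) (~~ visited q l)%:R * rho X q = 0.
  apply/eqP; rewrite eq_le sumr_ge0 // andbT.
  have := feas_SL1 X_feas l so; rewrite xi1 -subr_le0; apply: le_trans.
  rewrite -[X in _ <= X - _](feas_route X_feas o) -sumrB; apply: ler_sum => q _.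
  by case: (visited q l); rewrite ?mul0r ?mul1r ?subrr ?subr0.
have /eqP := psumr_eq0P F_ge0 F_sum (i := r) isT.
by rewrite mulf_eq0 (gt_eqF r_gt0) orbF pnatr_eq0 eqb0 negbK.
Qed.

(** The right-hand side is a weighted mean of the costs on the support, so the minimum there does
    not exceed it. *)
Lemma cheap_support_route o :
  exists2 r : route o, 0 < rho X r & cost r <= \sum_(q : route o) cost q * rho X q.
Proof.
have rho0 := @feas_rho_ge0 _ _ _ X_feas o.
have [r0 r0_gt0] : exists r : route o, 0 < rho X r.
  apply/existsP; apply: contraT; rewrite negb_exists => /forallP rho_le0.
  have := feas_route X_feas o; rewrite big1 => [/esym/eqP|r _].
    by rewrite oner_eq0.
  by apply/eqP; rewrite eq_le rho0 leNgt rho_le0.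
have [r r_gt0 r_min] := arg_minP (P := [pred r : route o | 0 < rho X r]) (@cost R I o) r0_gt0.
exists r => //; rewrite -[leLHS]mulr1 -(feas_route X_feas o) mulr_sumr.
apply: ler_sum => q _; have := rho0 q; rewrite le_eqVlt => /predU1P[<-|q_gt0].
  by rewrite !mulr0.
by rewrite ler_pM2r // r_min.
Qed.

Lemma demand_route o :
  exists r : route o, (forall l, visits r l = demand o l) /\
    cost r <= \sum_(q : route o) cost q * rho X q.
Proof.
have [r r_gt0 r_cheap] := cheap_support_route o.
have [r' [r'd r'r]] := route_with_visits (demand_le_cap o) (sum_demand o)
  (fun l => support_visited l r_gt0).
by exists r'; rewrite r'r.
Qed.

End Orders.

Lemma sum_indicator (R : pzRingType) (T : finType) (x : T) (F : T -> R) :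
  \sum_y F y * (y == x)%:R = F x.
Proof.
rewrite (bigD1 x) //= eqxx mulr1 big1 ?addr0 // => y /negPf->.
by rewrite mulr0.
Qed.

Theorem theorem2 (R : realType) (I : instance R) (X : solution I)
    (X_opt : optimal X) (xi_int : xi_integral X) :
  integral_solution X \/
  exists X' : solution I,
    [/\ feasible X', integral_solution X' & objective X' = objective X].
Proof.
(* The second alternative can always be reached: [xi] is kept and only the routes are replaced. *)
right; have [X_feas X_min] := X_opt.
have [f f_spec] := fin_all_exists (demand_route X_feas xi_int).
pose X' := Solution (xi X) (fun o r => (r == f o)%:R).
have X'_feas : feasible X'.
  split=> //=; try by case: X_feas.
  - by move=> o; under eq_bigr do rewrite -[_%:R]mul1r; rewrite sum_indicator.
  - move=> l o; rewrite sum_indicator -(demandE X_feas xi_int).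
    by have [-> _] := f_spec o.
  - move=> l o s so; rewrite sum_indicator (xi_01 X_feas xi_int) ler_nat.
    (* Otherwise the bound is 0. If the value is 1, then [s] itself counts in the demand at [l], so
       the chosen route stops there. *)
    have [xi1|//] := eqVneq (xi X l s) 1.
    rewrite lt0b /visited; have [-> _] := f_spec o.
    by apply/card_gt0P; exists s; rewrite inE so xi1 eqxx.
exists X'; split=> //; first by split=> // o r; apply: rpred_nat.
(* Optimality of [X] gives one inequality; the other holds order by order. *)
apply/le_anti; rewrite X_min // andbT; apply: ler_sum => o _ /=.
by rewrite sum_indicator; have [] := f_spec o.
Qed.
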